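(* Let $Q$ be a rack, let $\ell\ge1$, and assume that $w\in C_\ell^R(Q)$ is an extreme chain. Then $h_w\colon C_n^R(Q)\to C_{n+\ell}^R(Q)$ is a chain map, and $(h_w)_*\colon H_n^R(Q)\to H_{n+\ell}^R(Q)$ is a homological operation. Furthermore, if $Q$ is a quandle, then, because $h_w$ sends degenerate elements to degenerate elements, $h_w$ is a chain map on quandle chains $C_n^Q(Q)\to C_{n+\ell}^Q(Q)$ (for this statement it is only required that $\partial^0(w)$ and all partial derivatives $\frac{\partial^1w}{\partial q}$ be zero as quandle chains, i.e. in $C_{\ell-1}^Q(Q)$).
   Context: A rack is a set $Q$ with a binary operation $*$ such that for all $a,b$ there is a unique $c$ with $a=c*b$, and $(a*b)*c=(a*c)*(b*c)$. A quandle is a rack with $a*a=a$. $C_n^R(Q)=\mathbb{Z}Q^n$ is the free abelian group on $n$-tuples ($C_0^R(Q)=\mathbb{Z}$, generated by the empty tuple). Put $$\partial_i^0(x_1,\ldots,x_n)=(x_1,\ldots,x_{i-1},x_{i+1},\ldots,x_n),\quad \partial_i^1(x_1,\ldots,x_n)=(x_1*x_i,\ldots,x_{i-1}*x_i,x_{i+1},\ldots,x_n),$$ $\partial^0=\sum_{i=1}^n(-1)^i\partial^0_i$, $\partial^1=\sum_{i=1}^n(-1)^i\partial_i^1$, and boundary $\partial=\partial^0-\partial^1$; $H_n^R(Q)$ is the homology of $(C_*^R(Q),\partial)$, $n\ge1$. For a quandle $Q$, $C_n^D(Q)$ is the subcomplex generated by tuples with $x_i=x_{i+1}$ for some $i$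 (degenerate elements), and $C_n^Q(Q)=C_n^R(Q)/C_n^D(Q)$. For $q\in Q$ the partial derivative $\frac{\partial^1}{\partial q}\colon C_n^R(Q)\to C_{n-1}^R(Q)$ is the linear map with $\frac{\partial^1(x_1,\ldots,x_n)}{\partial q}=\sum_{i=1}^n(-1)^i\delta_{x_i,q}\,\partial_i^1(x_1,\ldots,x_n)$, where $\delta_{x_i,q}=1$ if $x_i=q$ and $0$ otherwise. A chain $w\in C_\ell^R(Q)$ is extreme if $\partial^0(w)=0$ and $\frac{\partial^1w}{\partial q}=0$ for all $q\in Q$. The map $h_w\colon C_n^R(Q)\to C_{n+\ell}^R(Q)$ ($n\ge1$) is $h_w(x_1,\ldots,x_n)=(x_1,\ldots,x_n,w)$, extended linearly in $w$ and in $(x_1,\ldots,x_n)$. A homological operation of degree $d$ is a homomorphism $H_*^R\to H_{*+d}^R$. *)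

(* Defs.v *)
From HB Require Import structures.
From mathcomp Require Import all_boot all_algebra.
From mathcomp Require Import boolp.
From mathcomp.multinomials Require Import freeg.
From mathcomp Require Import zify.

Set Implicit Arguments.
Unset Strict Implicit.
Unset Printing Implicit Defensive.

Import GRing.Theory.
Local Open Scope ring_scope.
Local Open Scope quotient_scope.

(* The carrier is a choiceType because tuples serve as the keys of free abelian
   groups; every type carries such a structure classically. *)
HB.mixin Record isRack Q of Choice Q := {
  rack_op : Q -> Q -> Q;
  rack_divP : forall a b : Q, exists! c : Q, a = rack_op c b;
  rack_opD : forall a b c : Q,
    rack_op (rack_op a b) c = rack_op (rack_op a c) (rack_op b c)
}.
#[short(type="rackType")]
HB.structure Definition Rack := {Q of isRack Q & Choice Q}.

HB.mixin Record Rack_isQuandle Q of Rack Q := {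
  rack_idem : forall a : Q, rack_op a a = a
}.
#[short(type="quandleType")]
HB.structure Definition Quandle := {Q of Rack_isQuandle Q & Rack Q}.

Declare Scope rack_scope.
Delimit Scope rack_scope with rack.
Notation "x ◃ y" := (rack_op x y) (at level 40, left associativity) : rack_scope.
Local Open Scope rack_scope.

(* The differential of degree n has codomain of degree n.-1; degree -1 is thus
   represented by degree 0, and [diff 0] plays no role in the homology in
   positive degrees. *)
Record complex := Complex {
  complex_obj :> nat -> zmodType;
  diff : forall n, {additive complex_obj n -> complex_obj n.-1};
  diff_diff : forall n (x : complex_obj n), diff n.-1 (diff n x) = 0
}.
Arguments diff {c n}.

Section Homology.
Variable C : complex.

Section Degree.
Variable n : nat.

Definition is_cycle : {pred C n} := fun x => diff x == 0.

Lemma is_cycle_zmod_closed : zmod_closed is_cycle.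
Proof.
split=> [|x y]; rewrite !unfold_in ?raddf0 // => /eqP dx /eqP dy.
by rewrite raddfB dx dy subr0.
Qed.
HB.instance Definition _ :=
  GRing.isZmodClosed.Build (C n) is_cycle is_cycle_zmod_closed.

Record cycles := Cycle { cycle_val : C n; _ : cycle_val \in is_cycle }.

HB.instance Definition _ := [isSub for cycle_val].
HB.instance Definition _ := [Choice of cycles by <:].
HB.instance Definition _ := [SubChoice_isSubZmodule of cycles by <:].

Definition is_boundary : {pred cycles} :=
  fun z => `[< exists y : C n.+1, diff y = val z >].

Lemma is_boundary_zmod_closed : zmod_closed is_boundary.
Proof.
split=> [|x y]; rewrite !unfold_in.
  by apply/asboolP; exists 0; rewrite !raddf0.
move=> /asboolP[x' dx] /asboolP[y' dy]; apply/asboolP; exists (x' - y').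
by rewrite !raddfB /= dx dy.
Qed.
HB.instance Definition _ :=
  GRing.isZmodClosed.Build cycles is_boundary is_boundary_zmod_closed.

Definition homology := Quotient.quot is_boundary.
HB.instance Definition _ := GRing.Zmodule.on homology.

Definition homology_class (z : cycles) : homology := \pi_homology z.

End Degree.

(* Squares C_{n.+1} -> C_n, i.e. in every positive degree; the codomain degrees
   (n.+1 + l).-1 and n + l are convertible. *)
Definition chain_map (l : nat) (f : forall n, {additive C n -> C (n + l)%N}) :=
  forall n (x : C n.+1), diff (f n.+1 x) = f n (diff x) :> C (n + l)%N.

(* Homology is considered in positive degrees only. *)
Definition homological_operation (d : nat) :=
  forall n, {additive homology n.+1 -> homology (n.+1 + d)}.

Definition induces (l : nat) (f : forall n, {additive C n -> C (n + l)%N})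
    (F : homological_operation l) :=
  forall n (z : cycles n.+1), exists2 z' : cycles (n.+1 + l),
    val z' = f n.+1 (val z) & F n (homology_class z) = homology_class z'.

End Homology.

Section QuotientMap.
Variables (V W : zmodType) (I : zmodClosed V) (J : zmodClosed W).
Variable f : {additive V -> W}.

Definition quot_map (x : Quotient.quot I) : Quotient.quot J :=
  \pi_(Quotient.quot J) (f (repr x)).

Hypothesis f_IJ : {in I, forall x, f x \in J}.

Lemma quot_map_pi x :
  quot_map (\pi_(Quotient.quot I) x) = \pi_(Quotient.quot J) (f x).
Proof.
apply/eqP; rewrite /quot_map -Quotient.idealrBE -raddfB f_IJ //.
by rewrite Quotient.idealrBE reprK.
Qed.

Lemma quot_map_zmod_morphism : zmod_morphism quot_map.
Proof.
move=> x y; rewrite -[x]reprK -[y]reprK -raddfB !quot_map_pi.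
by rewrite !raddfB.
Qed.
End QuotientMap.
Arguments quot_map {V W} I J f x.

HB.instance Definition _ (R : nzRingType) (M : lmodType R) (K : choiceType)
    (f : K -> M) :=
  GRing.isZmodMorphism.Build {freeg K / R} M (fglift f) (lift_is_additive f).

Notation chain Q n := {freeg (n.-tuple Q) / int}.

Lemma freeg_ext (K : choiceType) (W : zmodType)
    (f g : {additive {freeg K / int} -> W}) :
  (forall k, f << k >> = g << k >>) -> f =1 g.
Proof.
move=> fg x; rewrite -[x]freeg_sumE !raddf_sum; apply: eq_bigr => k _.
by rewrite -[coeff k x]intz -freegU_mulz !raddfMz fg.
Qed.

Section RackChains.
Variable Q : rackType.
Implicit Types (n l : nat) (q : Q).

(* Positions are numbered from 0, whence the signs (-1) ^+ i.+1 below. *)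
Definition face0 n (i : 'I_n) (t : n.-tuple Q) : n.-1.-tuple Q :=
  [tuple tnth t (fintype.lift i j) | j < n.-1].

Definition face1 n (i : 'I_n) (t : n.-tuple Q) : n.-1.-tuple Q :=
  [tuple if (j < i)%N then tnth t (fintype.lift i j) ◃ tnth t i
         else tnth t (fintype.lift i j) | j < n.-1].

Definition bd0 n : chain Q n -> chain Q n.-1 :=
  fglift (fun t => \sum_(i < n) (-1) ^+ i.+1 *: << face0 i t >>).

Definition bd1 n : chain Q n -> chain Q n.-1 :=
  fglift (fun t => \sum_(i < n) (-1) ^+ i.+1 *: << face1 i t >>).

Definition pderiv n q : chain Q n -> chain Q n.-1 :=
  fglift (fun t =>
    \sum_(i < n) (tnth t i == q)%:R *: ((-1) ^+ i.+1 *: << face1 i t >>)).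

HB.instance Definition _ n :=
  GRing.isZmodMorphism.Build (chain Q n) (chain Q n.-1) (@bd0 n)
    (lift_is_additive _).
HB.instance Definition _ n :=
  GRing.isZmodMorphism.Build (chain Q n) (chain Q n.-1) (@bd1 n)
    (lift_is_additive _).
HB.instance Definition _ n q :=
  GRing.isZmodMorphism.Build (chain Q n) (chain Q n.-1) (@pderiv n q)
    (lift_is_additive _).

Definition bd n (x : chain Q n) : chain Q n.-1 := bd0 x - bd1 x.

Lemma bd_zmod_morphism n : zmod_morphism (@bd n).
Proof. by move=> x y; rewrite /bd !raddfB addrACA. Qed.
HB.instance Definition _ n :=
  GRing.isZmodMorphism.Build (chain Q n) (chain Q n.-1) (@bd n)
    (@bd_zmod_morphism n).

Definition face (b : bool) n (i : 'I_n) (t : n.-tuple Q) :=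
  if b then face1 i t else face0 i t.

Lemma tnth_face b n (i : 'I_n) t k :
  tnth (face b i t) k =
    if b && (k < i)%N then tnth t (fintype.lift i k) ◃ tnth t i
    else tnth t (fintype.lift i k).
Proof. by case: b; rewrite tnth_mktuple. Qed.

Lemma bdU n (t : n.-tuple Q) :
  bd << t >> = \sum_(b : bool) \sum_(i < n) (-1) ^+ (b + i.+1) *: << face b i t >>.
Proof.
rewrite big_bool /= /bd /bd0 /bd1 !liftU !scale1r [LHS]addrC -sumrN.
by congr (_ + _); apply: eq_bigr => i _; rewrite -scaleNr -mulN1r -exprS.
Qed.

Lemma face_face a b n (i : 'I_n.+1) (j : 'I_n.+2) (i' : 'I_n.+2) (j' : 'I_n.+1) t :
  (i < j)%N -> i' = i :> nat -> j' = j.-1 :> nat ->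
  face a i (face b j t) = face b j' (face a i' t) :> n.-tuple Q.
Proof.
move=> ij Ei Ej; apply: eq_from_tnth => k.
have Ek : fintype.lift j (fintype.lift i k) = fintype.lift i' (fintype.lift j' k).
  by apply/val_inj; rewrite /= /bump Ei Ej; lia.
have Eji : fintype.lift j i = i' by apply/val_inj; rewrite /= /bump Ei; lia.
have Eij : fintype.lift i' j' = j by apply/val_inj; rewrite /= /bump Ei Ej; lia.
rewrite (tnth_face a i) !(tnth_face b j) (tnth_face b j') !(tnth_face a i').
rewrite Ek Eji Eij.
have -> : (i < j)%N = true by [].
have -> : (j' < i')%N = false by rewrite Ei Ej; lia.
have -> : (fintype.lift i k < j)%N = (k < j')%N by rewrite /= /bump Ej; lia.
have -> : (fintype.lift j' k < i')%N = (k < i)%N by rewrite /= /bump Ei Ej; lia.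
rewrite andbT andbF.
have /implyP : (k < i)%N ==> (k < j')%N by apply/implyP; rewrite Ej; lia.
move: (tnth t _) (tnth t i') (tnth t j) => x y z.
case: a; case: b => //=; do 2 case: (_ < _)%N => //=; try by move/(_ isT).
by rewrite (rack_opD x y z).
Qed.

Lemma big_ltn_swap (V : nmodType) n (F : 'I_n.+2 -> 'I_n.+1 -> V) :
  \sum_(j < n.+2) \sum_(i < n.+1 | (i < j)%N) F j i =
  \sum_(j < n.+2) \sum_(i < n.+1 | ~~ (i < j)%N) F (inord i.+1) (inord j).
Proof.
rewrite !pair_big_dep /=.
pose h (p : 'I_n.+2 * 'I_n.+1) : 'I_n.+2 * 'I_n.+1 := (inord p.2.+1, inord p.1).
pose h' (p : 'I_n.+2 * 'I_n.+1) : 'I_n.+2 * 'I_n.+1 := (inord p.2, inord p.1.-1).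
rewrite (reindex_onto h h') => [|[j i] /= ij]; last first.
  have [lti ltj] := (ltn_ord i, ltn_ord j).
  by congr (_, _); apply: val_inj; rewrite /= !inordK; lia.
apply: eq_bigl => -[j i] /=; have [lti ltj] := (ltn_ord i, ltn_ord j).
have Ei : (inord i.+1 : 'I_n.+2) = i.+1 :> nat by rewrite inordK.
have [ij|ji] := ltnP i j; last first.
  have Ej : (inord j : 'I_n.+1) = j :> nat by rewrite inordK; lia.
  rewrite Ei Ej ltnS ji /=; apply/eqP.
  by congr (_, _); apply: val_inj; rewrite /= ?Ei ?Ej inordK.
apply/negP => /andP[]; rewrite Ei => jo /eqP[/(congr1 val)/= + _].
have jo' := ltn_ord (inord j : 'I_n.+1).
by rewrite inordK; lia.
Qed.

Lemma bd_bd n (x : chain Q n) : bd (bd x) = 0.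
Proof.
suff /(_ x) : @bd n.-1 \o @bd n =1 \0 by [].
apply: freeg_ext => t; rewrite /= bdU raddf_sum /=.
have bdZ m (c : int) (y : chain Q m) : bd (c *: y) = c *: bd y.
  by rewrite -[c]intz !scaler_int raddfMz.
have bd_0 (u : 0.-tuple Q) : bd << u >> = 0.
  by rewrite bdU big1 // => b _; rewrite big_ord0.
case: n x t => [|n] x t.
  by apply: big1 => b _; rewrite big_ord0 raddf0.
case: n x t => [|n] x t.
  by apply: big1 => b _; rewrite big_ord1 bdZ bd_0 scaler0.
pose F (a b : bool) (j : 'I_n.+2) (i : 'I_n.+1) : chain Q n :=
  (-1) ^+ (b + j.+1) *: ((-1) ^+ (a + i.+1) *: << face a i (face b j t) >>).
have FE : \sum_(b : bool) bd (\sum_(j < n.+2) (-1) ^+ (b + j.+1) *: << face b j t >>)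
  = \sum_b \sum_a \sum_j \sum_i F a b j i.
  apply: eq_bigr => b _; rewrite raddf_sum exchange_big; apply: eq_bigr => j _.
  by rewrite /= bdZ bdU scaler_sumr; apply: eq_bigr => a _; rewrite scaler_sumr.
rewrite FE.
have -> : \sum_b \sum_a \sum_j \sum_i F a b j i =
    \sum_b \sum_a \sum_(j < n.+2) \sum_(i < n.+1 | (i < j)%N) F a b j i +
    \sum_b \sum_a \sum_(j < n.+2) \sum_(i < n.+1 | ~~ (i < j)%N) F a b j i.
  rewrite -big_split; apply: eq_bigr => b _; rewrite -big_split; apply: eq_bigr => a _.
  rewrite -big_split; apply: eq_bigr => j _.
  by rewrite (bigID (fun i : 'I_n.+1 => (i < j)%N)).
rewrite [X in _ + X]exchange_big -big_split /=; apply: big1 => b _.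
rewrite -big_split; apply: big1 => a _ /=.
rewrite big_ltn_swap -big_split; apply: big1 => j _ /=.
rewrite -big_split; apply: big1 => i /= ij.
have [lti ltj] := (ltn_ord i, ltn_ord j).
rewrite /F !scalerA -!exprD (face_face a b (i' := j) (j' := i)) ?inordK //=; try lia.
have -> : (b + i.+2 + (a + j.+1) = (a + j.+1 + (b + i.+1)).+1)%N by lia.
by rewrite exprS mulN1r scaleNr addNr.
Qed.

Definition rack_complex : complex :=
  @Complex (fun n => chain Q n) (fun n => @bd n) bd_bd.

Definition degenerate n (t : n.-tuple Q) : bool :=
  [exists i : 'I_n, exists j : 'I_n,
    (j == i.+1 :> nat) && (tnth t i == tnth t j)].

Definition degenerate_chain n : {pred chain Q n} := fun x =>
  `[< exists2 s : seq (int * n.-tuple Q), all (fun ct => degenerate ct.2) s &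
        x = \sum_(ct <- s) ct.1 *: << ct.2 >> >].

Lemma degenerate_chain_zmod_closed n : zmod_closed (@degenerate_chain n).
Proof.
split=> [|x y]; rewrite !unfold_in.
  by apply/asboolP; exists [::]; rewrite // big_nil.
move=> /asboolP[s sP ->] /asboolP[r rP ->]; apply/asboolP.
exists (s ++ [seq (- ct.1, ct.2) | ct <- r]); first by rewrite all_cat sP all_map.
rewrite big_cat big_map -sumrN /=; congr (_ + _).
by apply: eq_bigr => ct _; rewrite scaleNr.
Qed.
HB.instance Definition _ n := GRing.isZmodClosed.Build (chain Q n)
  (@degenerate_chain n) (@degenerate_chain_zmod_closed n).

Lemma degenerate_chainU n (t : n.-tuple Q) :
  degenerate t -> << t >> \in @degenerate_chain n.
Proof.
move=> dt; rewrite unfold_in; apply/asboolP; exists [:: (1, t)] => /=.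
  by rewrite dt.
by rewrite big_seq1 scale1r.
Qed.

Lemma degenerate_chain_hom n (W : zmodType) (J : zmodClosed W)
    (f : {additive chain Q n -> W}) :
  (forall t : n.-tuple Q, degenerate t -> f << t >> \in J) ->
  {in @degenerate_chain n, forall x, f x \in J}.
Proof.
move=> fJ x; rewrite unfold_in => /asboolP[s sP ->]; rewrite raddf_sum big_seq.
apply: rpred_sum => ct /(allP sP) dct.
by rewrite -[ct.1]intz scaler_int raddfMz rpredMz ?fJ.
Qed.

Definition quandle_chain n := Quotient.quot (@degenerate_chain n).
HB.instance Definition _ n := GRing.Zmodule.on (quandle_chain n).

Definition quandle_class n (x : chain Q n) : quandle_chain n :=
  \pi_(quandle_chain n) x.

Definition extreme l (w : chain Q l) : Prop :=
  bd0 w = 0 /\ forall q, pderiv q w = 0.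

Definition extreme_mod_degenerate l (w : chain Q l) : Prop :=
  quandle_class (bd0 w) = 0 /\ forall q, quandle_class (pderiv q w) = 0.

(* In degree 0 this sends the empty tuple to w, which is only needed to write
   the square in degree 1, where the source differential vanishes. *)
Definition append l (w : chain Q l) n : chain Q n -> chain Q (n + l)%N :=
  fglift (fun t : n.-tuple Q =>
    fglift (fun u : l.-tuple Q => << [tuple of t ++ u] >>) w).
HB.instance Definition _ l (w : chain Q l) n :=
  GRing.isZmodMorphism.Build (chain Q n) (chain Q (n + l)%N) (@append l w n)
    (lift_is_additive _).

Definition h_map l (w : chain Q l) n :
    {additive rack_complex n -> rack_complex (n + l)%N} :=
  @append l w n.

End RackChains.

Section QuandleChains.
Variable Q : quandleType.

Lemma bd_degenerate n :
  {in @degenerate_chain Q n, forall x, bd x \in @degenerate_chain Q n.-1}.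
Proof.
apply: degenerate_chain_hom => t /existsP[i /existsP[j /andP[/eqP ji /eqP tij]]] /=.
case: n t i j ji tij => [|n] t i j ji tij; first by case: i ji tij.
rewrite bdU; apply: rpred_sum => b _.
have neq_ji : j != i by rewrite -val_eqE /= ji; lia.
rewrite (bigD1 i) //= (bigD1 j) //= addrA rpredD //.
  have -> : face b i t = face b j t :> n.-tuple Q.
    apply: eq_from_tnth => k; rewrite (tnth_face b i) (tnth_face b j) -tij.
    have [ki|ki] := eqVneq (k : nat) i; last first.
      have -> : (k < j)%N = (k < i)%N by lia.
      by have -> // : fintype.lift j k = fintype.lift i k
        by apply: val_inj; rewrite /= /bump; lia.
    have -> : (k < i)%N = false by lia.
    have -> : (k < j)%N by lia.
    have -> : fintype.lift i k = j by apply: val_inj; rewrite /= /bump; lia.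
    have -> : fintype.lift j k = i by apply: val_inj; rewrite /= /bump; lia.
    by rewrite andbF andbT -tij; case: b => //; rewrite rack_idem.
  rewrite ji (_ : (b + i.+2 = (b + i.+1).+1)%N); last by lia.
  by rewrite exprS mulN1r scaleNr subrr rpred0.
apply: rpred_sum => k /andP[ki kj].
rewrite -[X in X *: _]intz scaler_int rpredMz //; apply: degenerate_chainU.
have [i' Ei Ui] := unlift_some ki; have [j' Ej Uj] := unlift_some kj.
apply/existsP; exists i'; apply/existsP; exists j'.
have [Eij Lij] : j' = i'.+1 :> nat /\ (j' < k)%N = (i' < k)%N.
  have bumpS (c d e m : nat) : m = bump c d -> m.+1 = bump c e ->
      e = d.+1 /\ (e < c)%N = (d < c)%N.
    by rewrite /bump; case: leqP => ?; case: leqP => ? /=; lia.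
  by apply: (bumpS k i' j' i); rewrite -?ji;
    [exact: (congr1 val Ei) | exact: (congr1 val Ej)].
by rewrite Eij eqxx /= !(tnth_face b k) -Ei -Ej -tij Lij.
Qed.

Definition quandle_bd n : quandle_chain Q n -> quandle_chain Q n.-1 :=
  quot_map (@degenerate_chain Q n) (@degenerate_chain Q n.-1) (@bd Q n).

Lemma quandle_bd_class n (x : chain Q n) :
  quandle_bd (quandle_class x) = quandle_class (bd x).
Proof. exact: quot_map_pi (@bd_degenerate n) x. Qed.

HB.instance Definition _ n :=
  GRing.isZmodMorphism.Build (quandle_chain Q n) (quandle_chain Q n.-1)
    (@quandle_bd n) (quot_map_zmod_morphism (@bd_degenerate n)).

Lemma quandle_bd_bd n (x : quandle_chain Q n) : quandle_bd (quandle_bd x) = 0.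
Proof.
rewrite -[x]reprK !quandle_bd_class bd_bd.
exact: (raddf0 \pi_(quandle_chain Q n.-1.-1)).
Qed.

Definition quandle_complex : complex :=
  @Complex (fun n => quandle_chain Q n) (fun n => @quandle_bd n) quandle_bd_bd.

End QuandleChains.

(* Main.v *)
Require Import Defs.
From HB Require Import structures.
From mathcomp Require Import all_boot all_algebra.
From mathcomp Require Import boolp.
From mathcomp.multinomials Require Import freeg.
From mathcomp Require Import zify.

Set Implicit Arguments.
Unset Strict Implicit.
Unset Printing Implicit Defensive.

Import GRing.Theory.
Local Open Scope ring_scope.
Local Open Scope quotient_scope.
Local Open Scope rack_scope.

(** Why the theorem holds.  Split the faces of a concatenation t ++ u according
    to their position.  A face at an entry of t affects only entries to its
    left, so it is (face of t) ++ u.  The faces at an entry u_j are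
    t ++ face0 j u and (t ◃ u_j) ++ face1 j u, where t ◃ q is the entrywise
    action: deleting u_j by the second kind of face also moves all of t.
    Summing with signs gives the Leibniz formula [bd_append], for |t| = n,

      bd (t, w) = (bd t, w) + (-1)^n ((t, bd0 w) - twist t w),

    with twist t u the signed sum of the tuples (t ◃ u_j) ++ face1 j u.

    The twist is controlled by the partial derivatives: grouping its terms by
    the value q = u_j, on which alone t ◃ u_j depends, yields

      twist t w = sum over q of (t ◃ q, pderiv q w)

    ([twist_pderiv]).  The sum is finite since w involves finitely many
    elements of Q.  So both error terms are built by prepending fixed tuples to
    bd0 w and to the chains pderiv q w.  They vanish if w is extreme; and since
    prepending a tuple preserves degeneracy, they are degenerate if bd0 w and
    all pderiv q w are.  [append_bd] treats the two cases at once, by looking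
    at the formula through an additive map that kills the error terms: the
    identity, or the projection to quandle chains.

    Appending w preserves degeneracy, since equal adjacent entries of t remain
    adjacent in t ++ u; this gives the map on quandle chains.  Passing from a
    chain map to homology is the usual argument on cycles and boundaries. *)

(** * Additive maps on free abelian groups *)

Lemma raddfZint (V W : lmodType int) (f : {additive V -> W}) (c : int) x :
  f (c *: x) = c *: f x.
Proof. by rewrite -[c]intz !scaler_int raddfMz. Qed.

Lemma fgliftE (M : lmodType int) (K : choiceType) (f : K -> M)
    (w : {freeg K / int}) :
  fglift f w = \sum_(k <- dom w) coeff k w *: f k.
Proof.
rewrite -{1}[w]freeg_sumE raddf_sum; apply: eq_bigr => k _.
exact: liftU.
Qed.

Lemma freeg_zmod_ind (K : choiceType) (P : {freeg K / int} -> Prop) :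
  P 0 -> (forall x y, P x -> P y -> P (x - y)) -> (forall k, P << k >>) ->
  forall w, P w.
Proof.
move=> P0 PB PU w.
have PN x : P x -> P (- x) by rewrite -sub0r; exact: PB.
have PD x y : P x -> P y -> P (x + y).
  by move=> Px Py; rewrite -[y]opprK; apply: PB => //; exact: PN.
rewrite -[w]freeg_sumE; apply: big_ind => // k _.
rewrite -[coeff k w]intz -freegU_mulz.
have PMn n : P (<< k >> *+ n).
  by elim: n => [|n IHn]; rewrite ?mulr0n // mulrS; exact: PD.
by case: (coeff k w) => n; [exact: PMn | exact: PN].
Qed.

(** * Faces and degeneracy of tuples as sequences *)

Section Rack.
Variable Q : rackType.

(** Both kinds of face at once, as plain sequences: faces of concatenations then
    follow from how take, drop and map act on a concatenation. *)
Lemma val_face b n (i : 'I_n) (t : n.-tuple Q) :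
  face b i t = [seq if b then x ◃ tnth t i else x | x <- take i t]
                 ++ drop i.+1 t :> seq Q.
Proof.
have lti := ltn_ord i; apply: (@eq_from_nth _ (tnth t i)) => [|k].
  by rewrite size_cat size_map size_takel ?size_drop !size_tuple; lia.
rewrite size_tuple => ltk.
have -> : nth (tnth t i) (face b i t) k = tnth (face b i t) (Ordinal ltk).
  by rewrite [RHS](tnth_nth (tnth t i)).
rewrite tnth_face nth_cat size_map size_takel ?size_tuple; last by lia.
rewrite (tnth_nth (tnth t i) t (fintype.lift _ _)) /= /bump.
case: ltnP => ki.
  rewrite (nth_map (tnth t i)) ?size_takel ?size_tuple; try lia.
  rewrite nth_take // add0n andbT.
  by case: b.
by rewrite andbF nth_drop; congr nth; lia.
Qed.

Lemma degenerateP n (t : n.-tuple Q) :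
  reflect (exists s1 x s2, t = s1 ++ x :: x :: s2 :> seq Q) (degenerate t).
Proof.
apply: (iffP existsP) => [[i /existsP[j /andP[/eqP ji /eqP tij]]]|].
  have [lti ltj] := (ltn_ord i, ltn_ord j).
  exists (take i t), (tnth t i), (drop j.+1 t).
  rewrite -{1}[val t](cat_take_drop i); congr (_ ++ _).
  rewrite (drop_nth (tnth t i)) ?size_tuple // -tnth_nth; congr (_ :: _).
  by rewrite -ji (drop_nth (tnth t i)) ?size_tuple // -tnth_nth -tij.
move=> [s1 [x [s2 ts]]].
have sz : n = (size s1 + (size s2).+2)%N by rewrite -(size_tuple t) ts size_cat.
have lti : (size s1 < n)%N by lia.
have ltj : ((size s1).+1 < n)%N by lia.
exists (Ordinal lti); apply/existsP; exists (Ordinal ltj).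
rewrite eqxx /= !(tnth_nth x) /= ts !nth_cat ltnn ltnNge leqnSn /=.
by rewrite subnn subSnn.
Qed.

Lemma degenerate_catl n l k (e : (n + l)%N = k) (t : n.-tuple Q)
    (u : l.-tuple Q) :
  degenerate t -> degenerate (tcast e [tuple of t ++ u]).
Proof.
move=> /degenerateP[s1 [x [s2 ts]]]; apply/degenerateP.
by exists s1, x, (s2 ++ u); rewrite val_tcast /= ts -catA.
Qed.

Lemma degenerate_catr n l k (e : (n + l)%N = k) (t : n.-tuple Q)
    (u : l.-tuple Q) :
  degenerate u -> degenerate (tcast e [tuple of t ++ u]).
Proof.
move=> /degenerateP[s1 [x [s2 us]]]; apply/degenerateP.
by exists (t ++ s1), x, s2; rewrite val_tcast /= us -catA.
Qed.

(** * The Leibniz formula for appending a chain *)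

Definition translate n (t : n.-tuple Q) (q : Q) : n.-tuple Q :=
  [tuple of [seq x ◃ q | x <- t]].

(** The total length k is a parameter because bd lands in degree
    (n.+1 + l).-1, which is not convertible to n.+1 + l.-1. *)
Definition prepend n l k (e : (n + l)%N = k) (t : n.-tuple Q) :
    chain Q l -> chain Q k :=
  fglift (fun u : l.-tuple Q => << tcast e [tuple of t ++ u] >>).
HB.instance Definition _ n l k (e : (n + l)%N = k) t :=
  GRing.isZmodMorphism.Build (chain Q l) (chain Q k) (@prepend n l k e t)
    (lift_is_additive _).

Lemma prependU n l k (e : (n + l)%N = k) (t : n.-tuple Q) (u : l.-tuple Q) :
  prepend e t << u >> = << tcast e [tuple of t ++ u] >>.
Proof. by rewrite /prepend liftU scale1r. Qed.

(** The contribution to bd1 (t, w) of the faces located in w, up to the sign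
    (-1) ^+ n which their shift by n positions produces. *)
Definition twist n l k (e : (n + l.-1)%N = k) (t : n.-tuple Q) :
    chain Q l -> chain Q k :=
  fglift (fun u : l.-tuple Q => \sum_(j < l) (-1) ^+ j.+1 *:
    << tcast e [tuple of translate t (tnth u j) ++ face true j u] >>).
HB.instance Definition _ n l k (e : (n + l.-1)%N = k) t :=
  GRing.isZmodMorphism.Build (chain Q l) (chain Q k) (@twist n l k e t)
    (lift_is_additive _).

Lemma appendU l (w : chain Q l) n (t : n.-tuple Q) :
  append w << t >> = prepend erefl t w.
Proof. by rewrite /append liftU scale1r. Qed.

(** Additivity of the operator in the appended chain, so that the Leibniz
    formula need only be checked when that chain is a single tuple. *)
Lemma appendB l (v w : chain Q l) n (x : chain Q n) :
  append (v - w) x = append v x - append w x.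
Proof.
rewrite /append !fgliftE -sumrB; apply: eq_bigr => t _.
by rewrite raddfB scalerBr.
Qed.

Lemma append0l l n (x : chain Q n) : append (0 : chain Q l) x = 0.
Proof. by rewrite -(subrr 0) appendB subrr. Qed.

(** The term of index j depends on t only through t ◃ u_j; collecting the terms
    with u_j = q produces exactly the partial derivative at q.  S lists the
    finitely many elements of Q that occur in w; beyond it, all partial
    derivatives of w are zero. *)
Lemma twist_pderiv n l k (e : (n + l.-1)%N = k) (t : n.-tuple Q)
    (w : chain Q l) (S := undup (flatten [seq val u | u <- dom w])) :
  twist e t w = \sum_(q <- S) prepend e (translate t q) (pderiv q w).
Proof.
rewrite /twist fgliftE.
under [RHS]eq_bigr => q _ do rewrite /pderiv fgliftE raddf_sum.
rewrite exchange_big /= [LHS]big_seq [RHS]big_seq.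
apply: eq_bigr => u wu.
under [RHS]eq_bigr => q _ do rewrite raddfZint raddf_sum.
rewrite -scaler_sumr exchange_big /=; congr (_ *: _); apply: eq_bigr => j _.
(* For fixed u and j the factor (u_j == q) selects the single value q = u_j. *)
have Sj : tnth u j \in S.
  rewrite mem_undup; apply/flattenP; exists (val u); last exact: mem_tnth.
  exact: map_f.
rewrite (bigD1_seq (tnth u j)) ?undup_uniq //= eqxx scale1r [X in _ + X]big1.
  by rewrite addr0 raddfZint /= prependU.
by move=> q qj; rewrite [tnth u j == q]eq_sym (negPf qj) scale0r raddf0.
Qed.

(** Entries to the right of the deleted one are never altered. *)
Lemma face_catl b n l (t : n.+1.-tuple Q) (u : l.-tuple Q) (i : 'I_n.+1) :
  face b (lshift l i) [tuple of t ++ u] = [tuple of face b i t ++ u]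
    :> (n + l).-tuple Q.
Proof.
have lti := ltn_ord i; apply: val_inj.
rewrite [LHS]val_face /= val_face tnth_lshift -catA; congr (map _ _ ++ _).
  by rewrite takel_cat // size_tuple ltnW.
rewrite drop_cat size_tuple; case: ltnP => // ni.
by rewrite (@drop_oversize _ _ t) ?size_tuple // (eqP lti) drop0.
Qed.

(** All of t lies to the left of the deleted entry u_j, so a face of the second
    kind moves the whole of t. *)
Lemma face_catr b n l (e : (n.+1 + l.-1)%N = (n.+1 + l).-1)
    (t : n.+1.-tuple Q) (u : l.-tuple Q) (j : 'I_l) :
  face b (rshift n.+1 j) [tuple of t ++ u] =
    tcast e [tuple of (if b then translate t (tnth u j) else t) ++ face b j u].
Proof.
apply: val_inj; rewrite [RHS]val_tcast [LHS]val_face /= val_face tnth_rshift.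
have geF k : (n.+1 + k < n.+1)%N = false by lia.
rewrite take_cat size_tuple geF addKn drop_cat size_tuple -addnS geF addKn.
rewrite map_cat -catA; congr (_ ++ _).
by case: b => //; rewrite !map_id.
Qed.

Lemma bd_append n l (e : (n.+1 + l.-1)%N = (n.+1 + l).-1) (t : n.+1.-tuple Q)
    (w : chain Q l) :
  bd (append w << t >>) =
    (append w (bd << t >>) : chain Q (n + l)) +
    (-1) ^+ n.+1 *: (prepend e t (bd0 w) - twist e t w).
Proof.
elim/freeg_zmod_ind: w => [|v w IHv IHw|u].
- by rewrite !append0l ?(raddf0, addr0).
- rewrite !appendB raddfB /= IHv IHw opprD addrACA -scalerBr; congr (_ + _ *: _).
  by rewrite opprD addrACA -opprD !raddfB.
rewrite appendU prependU !bdU.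
under eq_bigr => b _ do rewrite big_split_ord.
rewrite big_split; congr (_ + _).
  rewrite raddf_sum; apply: eq_bigr => b _; rewrite raddf_sum.
  apply: eq_bigr => i _; rewrite raddfZint /= appendU prependU.
  by rewrite -face_catl.
(* The faces located in u: position j in u is position n.+1 + j in t ++ u. *)
have sgn b (j : 'I_l) :
    (-1) ^+ (b + (n.+1 + j).+1) = (-1) ^+ n.+1 * (-1) ^+ b * (-1) ^+ j.+1 :> int.
  by rewrite -!exprD; congr (_ ^+ _); lia.
rewrite big_bool addrC /bd0 /twist !liftU !scale1r !raddf_sum.
rewrite scalerDr !scaler_sumr; congr (_ + _); apply: eq_bigr => j _.
  rewrite (sgn true) mulrN1 mulNr scaleNr -scalerA -scalerN.
  by rewrite -face_catr.
rewrite raddfZint /= prependU -[face0 j u]/(face false j u).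
by rewrite (sgn false) mulr1 -scalerA -face_catr.
Qed.

(** With g the identity this is the chain map property for extreme w; with g
    the projection to quandle chains, both hypotheses become conditions on w
    modulo degenerate chains. *)
Lemma append_bd l (w : chain Q l) n (W : zmodType)
    (g : {additive chain Q (n + l) -> W})
    (e : (n.+1 + l.-1)%N = (n.+1 + l).-1) :
  (forall t : n.+1.-tuple Q, g (prepend e t (bd0 w)) = 0) ->
  (forall (t : n.+1.-tuple Q) q, g (prepend e t (pderiv q w)) = 0) ->
  forall x : chain Q n.+1, g (bd (append w x)) = g (append w (bd x)).
Proof.
move=> g0 g1 x.
suff /(_ x) : (g \o @bd Q (n.+1 + l)) \o @append Q l w n.+1 =1
  g \o (@append Q l w n \o @bd Q n.+1) by [].
apply: freeg_ext => t /=; rewrite (bd_append e) twist_pderiv raddfD /=.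
rewrite -[X in X *: _]intz scaler_int raddfMz /=.
suff -> : g (prepend e t (bd0 w) -
    \sum_(q <- undup (flatten [seq val u | u <- dom w]))
      prepend e (translate t q) (pderiv q w)) = 0 by rewrite mul0rz addr0.
by rewrite raddfB raddf_sum big1 ?g0 ?subr0 // => q _; exact: g1.
Qed.

(** * Compatibility with degenerate chains *)

Lemma prepend_degenerate n l k (e : (n + l)%N = k) (t : n.-tuple Q) :
  {in @degenerate_chain Q l, forall v, prepend e t v \in @degenerate_chain Q k}.
Proof.
apply: degenerate_chain_hom => u du; rewrite /= prependU.
exact/degenerate_chainU/degenerate_catr.
Qed.

Lemma append_degenerate l (w : chain Q l) n :
  {in @degenerate_chain Q n,
    forall x, append w x \in @degenerate_chain Q (n + l)}.
Proof.
apply: degenerate_chain_hom => t dt; rewrite /= appendU /prepend fgliftE.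
apply: rpred_sum => u _; rewrite -[coeff u w]intz scaler_int rpredMz //.
exact/degenerate_chainU/degenerate_catl.
Qed.

Lemma quandle_class_eq0 n (x : chain Q n) :
  (quandle_class x == 0) = (x \in @degenerate_chain Q n).
Proof.
by rewrite -[in RHS](subr0 x) Quotient.idealrBE raddf0.
Qed.
End Rack.

(** * The map induced on homology by a chain map of degree l *)

Section InducedMap.
Variables (C : complex) (l : nat) (f : forall n, {additive C n -> C (n + l)%N}).
Hypothesis f_chain : chain_map f.

Lemma chain_map_cycle n (z : cycles C n.+1) :
  f n.+1 (val z) \in @is_cycle C (n.+1 + l).
Proof.
by rewrite unfold_in f_chain (eqP (valP z)) raddf0.
Qed.

Definition cycle_map n (z : cycles C n.+1) : cycles C (n.+1 + l) :=
  Cycle (chain_map_cycle z).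

Lemma cycle_map_zmod_morphism n : zmod_morphism (@cycle_map n).
Proof. by move=> x y; apply: val_inj; rewrite /= !raddfB. Qed.
HB.instance Definition _ n :=
  GRing.isZmodMorphism.Build (cycles C n.+1) (cycles C (n.+1 + l))
    (@cycle_map n) (@cycle_map_zmod_morphism n).

Lemma cycle_map_boundary n :
  {in @is_boundary C n.+1, forall z, cycle_map z \in @is_boundary C (n.+1 + l)}.
Proof.
move=> z; rewrite !unfold_in => /asboolP[y dy]; apply/asboolP.
(* A composition of terms: (n.+2 + l).-1 and n.+1 + l agree by conversion only. *)
exists (f n.+2 y).
exact: etrans (f_chain y) (congr1 (fun v => f n.+1 v) dy).
Qed.

Definition homology_map n : homology C n.+1 -> homology C (n.+1 + l) :=
  quot_map (@is_boundary C n.+1) (@is_boundary C (n.+1 + l)) (@cycle_map n).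
HB.instance Definition _ n :=
  GRing.isZmodMorphism.Build (homology C n.+1) (homology C (n.+1 + l))
    (@homology_map n) (quot_map_zmod_morphism (@cycle_map_boundary n)).

Lemma chain_map_induces :
  exists F : homological_operation C l, induces f F.
Proof.
exists (fun n => @homology_map n) => n z; exists (cycle_map z) => //.
exact: quot_map_pi (@cycle_map_boundary n) z.
Qed.
End InducedMap.

(** * The operation on quandle chains *)

Section QuandleAppend.
Variables (Q : quandleType) (l : nat) (w : chain Q l).

Definition quandle_append n : quandle_chain Q n -> quandle_chain Q (n + l) :=
  quot_map (@degenerate_chain Q n) (@degenerate_chain Q (n + l))
    (@append Q l w n).
HB.instance Definition _ n :=
  GRing.isZmodMorphism.Build (quandle_chain Q n) (quandle_chain Q (n + l))
    (@quandle_append n) (quot_map_zmod_morphism (@append_degenerate Q l w n)).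

Lemma quandle_append_class n (x : chain Q n) :
  quandle_append (quandle_class x) = quandle_class (append w x).
Proof. exact: quot_map_pi (@append_degenerate Q l w n) x. Qed.
End QuandleAppend.

Theorem theorem4p5 (l : nat) (l_gt0 : (0 < l)%N) :
  (forall (Q : rackType) (w : chain Q l), extreme w ->
     chain_map (h_map w) /\
     exists hw_star : homological_operation (rack_complex Q) l,
       induces (h_map w) hw_star)
  /\
  (forall (Q : quandleType) (w : chain Q l), extreme_mod_degenerate w ->
     (forall n (x : chain Q n),
        x \in @degenerate_chain Q n ->
        h_map w n x \in @degenerate_chain Q (n + l)) /\
     exists hw_Q : forall n,
         {additive quandle_complex Q n -> quandle_complex Q (n + l)%N},
       (forall n (x : chain Q n),
          hw_Q n (quandle_class x) = quandle_class (h_map w n x)) /\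
       chain_map hw_Q).
Proof.
have e n : (n.+1 + l.-1)%N = (n.+1 + l).-1 by lia.
split=> [Q w [w0 w1]|Q w [w0 w1]].
  have hw_chain : chain_map (h_map w).
    move=> n x; apply: (@append_bd Q l w n _ idfun (e n)) => [t|t q] /=.
      by rewrite w0 raddf0.
    by rewrite w1 raddf0.
  by split=> //; exact: chain_map_induces.
split=> [n x|]; first exact: append_degenerate.
exists (fun n => @quandle_append Q l w n); split=> [n x|n x].
  exact: quandle_append_class.
rewrite -[x]reprK /= quandle_append_class !quandle_bd_class.
rewrite quandle_append_class.
have deg0 (v : chain Q l.-1) (t : n.+1.-tuple Q) : quandle_class v = 0 ->
    quandle_class (prepend (e n) t v) = 0.
  move=> /eqP; rewrite quandle_class_eq0 => dv; apply/eqP.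
  by rewrite quandle_class_eq0 prepend_degenerate.
apply: (@append_bd Q l w n _ \pi_(quandle_chain Q (n + l)) (e n)) => [t|t q].
  exact: deg0.
exact: deg0.
Qed.
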